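(* Let $m\in\mathbb{N}\setminus\{0,1\}$. Let $\widehat U_1:\mathcal{X}\to\mathcal{X}\times\mathcal{X}$ be given either by $\widehat U_1b=U_1(0,b)$ (case 1) or by $\widehat U_1b=U_1(b,b)$ (case 2). For every $n\in\{1,\ldots,m-1\}$ and $i\in\{2,\ldots,n\}$, let $$a_{i,n}=\frac12\sup_{p\in\mathbb{N}}\left(\beta_{i,n,p}^2+\widetilde\beta_{i,n,p}^2+\eta_{i,n}^2+\sqrt{(\beta_{i,n,p}^2+\widetilde\beta_{i,n,p}^2+\eta_{i,n}^2)^2-4\beta_{i,n,p}^2\eta_{i,n}^2}\right),$$ and for $i\in\{2,\ldots,m\}$ let $\overline a_{i,m}=\sup_{p}(\beta_{i,m,p}^2+\widetilde\beta_{i,m,p}^2)$. For $n\in\{1,\ldots,m-1\}$ let $\widehat a_{1,n}=(\sup_p\widetilde\beta_{1,n,p}^2)+\eta_{1,n}^2$ in case 1 and $\widehat a_{1,n}=(\sup_p(\beta_{1,n,p}+\widetilde\beta_{1,n,p})^2)+\eta_{1,n}^2$ in case 2; let $\widehat a_{1,m}=\sup_p\widetilde\beta_{1,m,p}^2$ in case 1 and $\widehat a_{1,m}=\sup_p(\beta_{1,m,p}+\widetilde\beta_{1,m,p})^2$ in case 2. Define recursively $$\widehat\theta_n=\sqrt{\widehat a_{1,n}}+\sum_{i=2}^n\widehat\theta_{i-1}\sqrt{a_{i,n}}\quad(n\in\{1,\ldots,m-1\}),\qquad \widehat\theta_m=\sqrt{\widehat a_{1,m}}+\sum_{i=2}^m\widehat\theta_{i-1}\sqrt{\overline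 a_{i,m}}.$$ Then, in each case, the network $$R_m\circ\overline U_m\circ Q_{m-1}\circ U_{m-1}\circ\cdots\circ Q_2\circ U_2\circ Q_1\circ\widehat U_1:\mathcal{X}\to\mathcal{X}$$ is $\widehat\theta_m/2^{m-1}$-Lipschitz.
   Context: $\mathcal{X},\mathcal{Y}$ are real Hilbert spaces of functions on $]0,1[$ (typically $L^2(0,1)$); $T:\mathcal{X}\to\mathcal{Y}$ is a compact linear integral operator $(Tx)(t)=\int_0^1 k(t,s)x(s)\,ds$ with $k\in L^2([0,1]^2)$; $D$ is a bounded linear operator from $\mathcal{X}$ to a real Hilbert space. $T^*T$ and $D^*D$ commute and are diagonalized in a common orthonormal basis $(v_p)_{p\in\mathbb{N}}$ of $\mathcal{X}$, with eigenvalues $(\beta_{T,p})_p$ and $(\beta_{D,p})_p$ respectively. $g:\mathcal{X}\to\,]-\infty,+\infty]$ is proper, lower semicontinuous and convex. For $n\in\{1,\ldots,m\}$, $\lambda_n,\mu_n,\tau_n,\eta_n$ are positive reals. $\mathrm{Id}$ is the identity. The proximity operator is $\mathrm{prox}_{f}(x)=\operatorname{argmin}_{y}\,(f(y)+\frac12\|x-y\|^2)$. $R_n=\mathrm{prox}_{\lambda_n\mu_ng}$, $W_n=\mathrm{Id}-\lambda_nT^*T-\lambda_n\tau_nD^*D$ on $\mathcal{X}$. On $\mathcal{X}\times\mathcal{X}$, with norm $\|(x,b)\|=\sqrt{\|x\|^2+\|b\|^2}$: $U_n(x,b)=(W_nx+\lambda_nb,\ \eta_nb)$ and $Q_n(x,b)=(R_nx,\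 b)$. $\overline U_m:\mathcal{X}\times\mathcal{X}\to\mathcal{X}$, $\overline U_m(x,b)=W_mx+\lambda_mb$. For $1\le i\le n\le m$ and $p\in\mathbb{N}$: $\beta_p^{(n)}=1-\lambda_n(\beta_{T,p}+\tau_n\beta_{D,p})$; $\beta_{i,n,p}=\prod_{j=i}^n\beta_p^{(j)}$; $\eta_{i,j}=\eta_j\cdots\eta_i$ if $j\ge i$ and $\eta_{i,j}=1$ otherwise; $\widetilde\beta_{i,n,p}=\sum_{j=i}^{n-1}\beta_p^{(n)}\cdots\beta_p^{(j+1)}\lambda_j\eta_{i,j-1}+\lambda_n\eta_{i,n-1}$ (an empty sum is $0$). *)

(* Defs.v *)
From HB Require Import structures.
From mathcomp Require Import all_boot all_order all_algebra.
From mathcomp Require Import all_classical all_reals all_analysis.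
Import Order.TTheory GRing.Theory Num.Theory.
Import numFieldNormedType.Exports.

Set Implicit Arguments.
Unset Strict Implicit.
Unset Printing Implicit Defensive.

Local Open Scope classical_set_scope.
Local Open Scope ring_scope.

HB.mixin Record CompleteNormedModule_isHilbert (R : realType) V
    of CompleteNormedModule R V := {
  dot : V -> V -> R ;
  dotC : forall x y, dot x y = dot y x ;
  dotDl : forall x y z, dot (x + y) z = dot x z + dot y z ;
  dotZl : forall a x y, dot (a *: x) y = a * dot x y ;
  dotxx : forall x, dot x x = `|x| ^+ 2
}.

#[short(type="hilbertType")]
HB.structure Definition Hilbert (R : realType) :=
  {V of CompleteNormedModule R V & CompleteNormedModule_isHilbert R V}.

Section hilbert_notions.
Context {R : realType}.

(* The Hilbert-space adjoint; the defining set is a singleton when A is a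
   bounded linear operator, by the Riesz representation theorem. *)
Definition adjoint {X Y : hilbertType R} (A : X -> Y) (y : Y) : X :=
  xget 0 [set z | forall x, dot (A x) y = dot x z].

Definition orthonormal_basis {X : hilbertType R} (v : nat -> X) :=
  (forall p q, dot (v p) (v q) = (p == q)%:R) /\
  (forall x, [series dot x (v p) *: v p]_p @ \oo --> x).

Definition compact_operator {X Y : normedModType R} (A : X -> Y) :=
  forall B : set X, bounded_set B -> precompact (A @` B).

Local Open Scope ereal_scope.

Definition proper_function {X : Type} (f : X -> \bar R) :=
  (forall x, f x != -oo) /\ (exists x, f x < +oo).

Definition econvex_function {X : lmodType R} (f : X -> \bar R) :=
  forall (t : R) x y, (0 < t < 1)%R ->
    f (t *: x + (1 - t) *: y)%R <= t%:E * f x + (1 - t)%:E * f y.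

Definition is_argmin {X : Type} (h : X -> \bar R) (y : X) :=
  forall z, h y <= h z.

(* For f proper, lower semicontinuous and convex the minimizer exists and is
   unique. *)
Definition prox {X : hilbertType R} (f : X -> \bar R) (x : X) : X :=
  xget 0%R [set y | is_argmin (fun y => f y + (2^-1 * `|x - y| ^+ 2)%:E) y].

End hilbert_notions.

Section function_spaces.
Context {R : realType}.
Local Notation mu := (@lebesgue_measure R).
Local Notation I01 := (`]0%R, 1%R[%classic : set R).
Local Notation J01 := (`[0%R, 1%R]%classic : set R).

(* X is a space of functions on ]0,1[ modulo a.e. equality: ev x is a
   representative of the class x. *)
Definition function_space {X : hilbertType R} (ev : X -> R -> R) :=
  [/\ forall x, measurable_fun I01 (ev x),
      forall (a : R) x y, {ae mu, forall t, I01 t ->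
        ev (a *: x + y) t = a * ev x t + ev y t} &
      forall x, {ae mu, forall t, I01 t -> ev x t = 0} -> x = 0].

Definition square_integrable_kernel (k : R * R -> R) :=
  measurable_fun (J01 `*` J01) k /\
  (\int[mu \x mu]_(z in J01 `*` J01) (k z ^+ 2)%:E < +oo)%E.

Definition integral_operator {X Y : hilbertType R} (evX : X -> R -> R)
    (evY : Y -> R -> R) (k : R * R -> R) (A : X -> Y) :=
  forall x, {ae mu, forall t, I01 t ->
    mu.-integrable I01 (fun s => (k (t, s) * evX x s)%:E) /\
    evY (A x) t = \int[mu]_(s in I01) (k (t, s) * evX x s)}.

End function_spaces.

Inductive input_case := zero_input | bias_input.

Section network.
Context {R : realType} {X Y Z : hilbertType R}.
Variables (T : X -> Y) (D : X -> Z) (g : X -> \bar R).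
Variables (lambda mu tau eta : nat -> R).

Definition R_ (n : nat) : X -> X :=
  prox (fun x => (lambda n * mu n)%:E * g x)%E.

Definition W_ (n : nat) (x : X) : X :=
  x - lambda n *: adjoint T (T x) - (lambda n * tau n) *: adjoint D (D x).

Definition U_ (n : nat) (u : X * X) : X * X :=
  (W_ n u.1 + lambda n *: u.2, eta n *: u.2).

Definition Q_ (n : nat) (u : X * X) : X * X := (R_ n u.1, u.2).

Definition Ubar (m : nat) (u : X * X) : X := W_ m u.1 + lambda m *: u.2.

Definition Uhat1 (c : input_case) (b : X) : X * X :=
  match c with
  | zero_input => U_ 1 (0, b)
  | bias_input => U_ 1 (b, b)
  end.

(* hidden c k = Q_(k+1) o U_(k+1) o ... o Q_2 o U_2 o Q_1 o Uhat1 *)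
Fixpoint hidden (c : input_case) (k : nat) : X -> X * X :=
  match k with
  | 0 => Q_ 1 \o Uhat1 c
  | k'.+1 => Q_ k.+1 \o U_ k.+1 \o hidden c k'
  end.

(* for m >= 2; the hidden layers are numbered 1, ..., m - 1 *)
Definition network (c : input_case) (m : nat) : X -> X :=
  R_ m \o Ubar m \o hidden c (m - 2).

End network.

Section lipschitz_constant.
Context {R : realType}.
Variables (lambda tau eta betaT betaD : nat -> R).

Definition beta (n p : nat) : R := 1 - lambda n * (betaT p + tau n * betaD p).

Definition betaprod (i n p : nat) : R := \prod_(i <= j < n.+1) beta j p.

Definition etaprod (i j : nat) : R := \prod_(i <= l < j.+1) eta l.

Definition betatilde (i n p : nat) : R :=
  \sum_(i <= j < n) betaprod j.+1 n p * lambda j * etaprod i j.-1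
  + lambda n * etaprod i n.-1.

Definition a_ (i n : nat) : R :=
  2^-1 * sup (range (fun p =>
    let s := betaprod i n p ^+ 2 + betatilde i n p ^+ 2 + etaprod i n ^+ 2 in
    s + Num.sqrt (s ^+ 2 - 4 * betaprod i n p ^+ 2 * etaprod i n ^+ 2))).

Definition abar (i m : nat) : R :=
  sup (range (fun p => betaprod i m p ^+ 2 + betatilde i m p ^+ 2)).

Definition ahat1_last (c : input_case) (m : nat) : R :=
  match c with
  | zero_input => sup (range (fun p => betatilde 1 m p ^+ 2))
  | bias_input => sup (range (fun p => (betaprod 1 m p + betatilde 1 m p) ^+ 2))
  end.

Definition ahat1 (c : input_case) (n : nat) : R :=
  ahat1_last c n + etaprod 1 n ^+ 2.

(* [:: theta_1; ...; theta_n] *)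
Fixpoint thetas (c : input_case) (n : nat) : seq R :=
  match n with
  | 0 => [::]
  | n'.+1 => let s := thetas c n' in
      rcons s (Num.sqrt (ahat1 c n)
               + \sum_(2 <= i < n.+1) s`_(i - 2) * Num.sqrt (a_ i n))
  end.

(* theta_n for 1 <= n <= m - 1 *)
Definition theta (c : input_case) (n : nat) : R := (thetas c n)`_(n.-1).

(* theta_m, whose layer has no output bias component *)
Definition theta_last (c : input_case) (m : nat) : R :=
  Num.sqrt (ahat1_last c m)
  + \sum_(2 <= i < m.+1) theta c i.-1 * Num.sqrt (abar i m).

Lemma size_thetas c n : size (thetas c n) = n.
Proof. by elim: n => //= n IHn; rewrite size_rcons IHn. Qed.

Lemma nth_thetas c n k : (k < n)%N -> (thetas c n)`_k = theta c k.+1.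
Proof.
elim: n => // n IHn; rewrite ltnS leq_eqVlt => /orP[/eqP-> //|kn].
by rewrite [thetas c n.+1]/= nth_rcons size_thetas kn IHn.
Qed.

Lemma thetaE c n : (0 < n)%N ->
  theta c n = Num.sqrt (ahat1 c n)
              + \sum_(2 <= i < n.+1) theta c i.-1 * Num.sqrt (a_ i n).
Proof.
case: n => // n _; rewrite {1}/theta [thetas c n.+1]/= nth_rcons size_thetas.
rewrite ltnn eqxx; congr (_ + _); rewrite big_nat [RHS]big_nat.
apply: eq_bigr => -[|[|i]] //= i_n; rewrite subn2 nth_thetas//.
Qed.

End lipschitz_constant.

(* Main.v *)
(** Write [Q_n] as the average of the identity and of its reflection
  [2 Q_n - Id], which is nonexpansive because a proximity operator is firmly
  nonexpansive. If [d_n] is [2^(n-1)] times the difference of the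
  preactivations of layer [n] for two inputs, this gives
  [d_(n+1) = U_(n+1) (d_n + e_n)] with [|e_n| <= |d_n|], so that [d_n] is the
  sum of the [U_n ... U_i e_(i-1)] over [1 <= i <= n], where [e_0] is the
  difference of the network inputs. Each product [U_n ... U_i] acts on the
  [p]-th coordinates by the matrix
  [[betaprod i n p, betatilde i n p], [0, etaprod i n]], whose largest singular
  value yields the coefficients [a_ i n]; the recursion defining [theta] then
  bounds [|d_n|]. *)

Require Import Defs.
From HB Require Import structures.
From mathcomp Require Import all_boot all_order all_algebra.
From mathcomp Require Import all_classical all_reals all_analysis.
From mathcomp Require Import ring lra.
Import Order.TTheory GRing.Theory Num.Theory.
Import numFieldNormedType.Exports.

Set Implicit Arguments.
Unset Strict Implicit.
Unset Printing Implicit Defensive.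

Local Open Scope classical_set_scope.
Local Open Scope ring_scope.

(** * Hilbert spaces *)

Lemma dotDr (R : realType) (X : hilbertType R) (x y z : X) :
  dot x (y + z) = dot x y + dot x z.
Proof. by rewrite dotC dotDl !(dotC x). Qed.

Lemma dotZr (R : realType) (X : hilbertType R) (a : R) (x y : X) :
  dot x (a *: y) = a * dot x y.
Proof. by rewrite dotC dotZl dotC. Qed.

Lemma dotNl (R : realType) (X : hilbertType R) (x y : X) :
  dot (- x) y = - dot x y.
Proof. by rewrite -scaleN1r dotZl mulN1r. Qed.

Lemma dotNr (R : realType) (X : hilbertType R) (x y : X) :
  dot x (- y) = - dot x y.
Proof. by rewrite dotC dotNl dotC. Qed.

Lemma dot0l (R : realType) (X : hilbertType R) (x : X) : dot 0 x = 0.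
Proof. by rewrite -(scale0r x) dotZl mul0r. Qed.

Lemma dot_suml (R : realType) (X : hilbertType R) (I : Type) (r : seq I)
    (F : I -> X) (y : X) :
  dot (\sum_(i <- r) F i) y = \sum_(i <- r) dot (F i) y.
Proof.
elim/big_rec2: _ => [|i a b _ <-]; first exact: dot0l.
by rewrite dotDl.
Qed.

Lemma sqr_normD (R : realType) (X : hilbertType R) (x y : X) :
  `|x + y| ^+ 2 = `|x| ^+ 2 + 2 * dot x y + `|y| ^+ 2.
Proof. by rewrite -!dotxx dotDl !dotDr (dotC y x); ring. Qed.

Lemma sqr_normB (R : realType) (X : hilbertType R) (x y : X) :
  `|x - y| ^+ 2 = `|x| ^+ 2 - 2 * dot x y + `|y| ^+ 2.
Proof. by rewrite sqr_normD dotNr normrN; ring. Qed.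

Lemma dot_le_norm (R : realType) (X : hilbertType R) (x y : X) :
  dot x y <= `|x| * `|y|.
Proof.
have : `|x + y| ^+ 2 <= (`|x| + `|y|) ^+ 2.
  by rewrite ler_sqr ?nnegrE ?addr_ge0// ler_normD.
by rewrite sqr_normD => h; lra.
Qed.

Lemma norm_dot_le (R : realType) (X : hilbertType R) (x y : X) :
  `|dot x y| <= `|x| * `|y|.
Proof.
rewrite ler_norml dot_le_norm andbT lerNl -dotNl.
by rewrite (le_trans (dot_le_norm _ _))// normrN.
Qed.

Lemma lipschitz_cvg (R : realType) (X : normedModType R) (f : X -> R) (C : R)
    (u : nat -> X) (l : X) :
  (forall x y, `|f x - f y| <= C * `|x - y|) ->
  u @ \oo --> l -> f (u n) @[n --> \oo] --> f l.
Proof.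
move=> fC /cvgrPdist_le ul; apply/cvgrPdist_le => e e0.
(* No sign is assumed on [C], hence the positive majorant [|C| + 1] as divisor. *)
have C0 : 0 < `|C| + 1 by rewrite ltr_wpDl.
have := ul _ (divr_gt0 e0 C0); apply: filterS => n /=.
rewrite ler_pdivlMr// mulrC => hn; rewrite (le_trans (fC _ _))//.
apply: le_trans hn; rewrite ler_wpM2r//.
by rewrite (le_trans (ler_norm C))// lerDl.
Qed.

Lemma cvg_dotl (R : realType) (X : hilbertType R) (u : nat -> X) (l y : X) :
  u @ \oo --> l -> dot (u n) y @[n --> \oo] --> dot l y.
Proof.
apply: (@lipschitz_cvg _ _ (fun x => dot x y) `|y|) => a b.
by rewrite -dotNl -dotDl mulrC norm_dot_le.
Qed.

(** * Proximity operators *)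

(** Real upper bounds replace the values of [f], so that later estimates stay in [R] even where [f]
    may be [+oo]. *)
Lemma econvex_le (R : realType) (X : lmodType R) (f : X -> \bar R)
    (t a b : R) (x y : X) :
  econvex_function f -> 0 < t < 1 -> (f x <= a%:E)%E -> (f y <= b%:E)%E ->
  (f (t *: x + (1 - t) *: y)%R <= (t * a + (1 - t) * b)%:E)%E.
Proof.
move=> cvx t01 fxa fyb; have /andP[t0 t1] := t01.
apply: le_trans (cvx _ _ _ t01) _; rewrite (EFinD (t * a)) !EFinM.
by apply: leeD; apply: lee_wpmul2l => //; rewrite lee_fin; lra.
Qed.

(** Otherwise some real [a] lies strictly between [c] and [f p]; semicontinuity eventually puts
    [f (u n)] above [a], while [r n] drops below [a]. *)
Lemma lsc_le_cvg (R : realType) (X : normedModType R) (f : X -> \bar R)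
    (u : nat -> X) (p : X) (r : nat -> R) (c : R) :
  lower_semicontinuous f -> u @ \oo --> p -> r @ \oo --> c ->
  (forall n, f (u n) <= (r n)%:E)%E -> (f p <= c%:E)%E.
Proof.
move=> lsc up rc fur; rewrite leNgt; apply/negP => cfp.
have [a ca afp] : exists2 a, c < a & (a%:E < f p)%E.
  case: (f p) cfp => [s| |//]; last by exists (c + 1); rewrite ?ltry//; lra.
  rewrite lte_fin => cs; exists ((c + s) / 2); first lra.
  by rewrite lte_fin; lra.
have [V Vp Vf] := lsc p a afp.
have : \forall n \near \oo, V (u n) /\ r n < a.
  near=> n; split; first by near: n; exact: up.
  by near: n; exact: (cvgr_lt c).
case=> N _ /(_ N (leqnn N)) [/Vf afu rNa].
by have := lt_le_trans afu (fur N); rewrite lte_fin; lra.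
Unshelve. all: by end_near. Qed.

(** A lower bound of linear growth, standing in for an affine minorant. Semicontinuity gives
    [f > c0 - 1] on a ball around [x0]; for [y] outside it, convexity on the segment from [x0] to
    [y] carries this bound outwards. *)
Lemma convex_lsc_minorant (R : realType) (X : normedModType R)
    (f : X -> \bar R) (x0 : X) (c0 : R) :
  econvex_function f -> lower_semicontinuous f -> f x0 = c0%:E ->
  exists2 B : R, 0 <= B &
    forall y r, (f y <= r%:E)%E -> c0 - 1 - B * `|y - x0| <= r.
Proof.
move=> cvx lsc fx0.
have [|V Vx0 Vf] := lsc x0 (c0 - 1); first by rewrite fx0 lte_fin; lra.
have [d /= d0 dV] := (@nbhs_ballP _ _ _ _).1 Vx0.
have near_x0 z : `|z - x0| < d -> ((c0 - 1)%:E < f z)%E.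
  by move=> zx0; apply: Vf; apply: dV; rewrite -ball_normE/= distrC.
exists (2 / d); first by rewrite divr_ge0// ltW.
move=> y r fyr; have [yd|dy] := ltP `|y - x0| d.
  have := lt_le_trans (near_x0 _ yd) fyr; rewrite lte_fin => cr.
  have : 0 <= 2 / d * `|y - x0| by rewrite mulr_ge0// divr_ge0// ltW.
  lra.
set s := `|y - x0| in dy *; have s0 : 0 < s by lra.
(* This weight puts the point of the segment at distance [d / 2] from [x0], inside the ball. Its
   inverse is [2 / d * s], which explains the slope [2 / d]. *)
pose t := d / (2 * s).
have t0 : 0 < t by rewrite divr_gt0// mulr_gt0.
have t1 : t < 1 by rewrite ltr_pdivrMr ?mulr_gt0//; lra.
have zE : t *: y + (1 - t) *: x0 - x0 = t *: (y - x0).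
  by rewrite scalerBl scale1r scalerBr addrA addrAC addrK.
have tsd : t * s = d / 2 by rewrite /t; field; rewrite gt_eqF.
have : `|t *: y + (1 - t) *: x0 - x0| < d.
  by rewrite zE normrZ gtr0_norm// tsd; lra.
have fx0c : (f x0 <= c0%:E)%E by rewrite fx0.
have t01 : 0 < t < 1 by rewrite t0.
move=> /near_x0 /lt_le_trans/(_ (econvex_le cvx t01 fyr fx0c)).
rewrite lte_fin => h.
have {}h : 0 < t * (r - c0) + 1 by lra.
have sd : 2 / d * s = t^-1 by rewrite /t; field; rewrite !gt_eqF.
have : 0 < t^-1 * (t * (r - c0) + 1) by rewrite mulr_gt0// invr_gt0.
rewrite mulrDr mulrA mulVf ?gt_eqF// mul1r mulr1 sd; lra.
Qed.

(** The weight [1 - 2^-1] is left unsimplified to match the midpoint produced by [econvex_le]. *)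
Lemma parallelogram (R : realType) (X : hilbertType R) (x y z : X) :
  `|x - (2^-1 *: y + (1 - 2^-1) *: z)| ^+ 2 =
  2^-1 * `|x - y| ^+ 2 + 2^-1 * `|x - z| ^+ 2 - 4^-1 * `|y - z| ^+ 2.
Proof.
rewrite !sqr_normB -!dotxx !(dotDl, dotDr, dotZl, dotZr) (dotC z y).
by field.
Qed.

(** Direct method: the parallelogram identity makes a minimizing sequence Cauchy, and semicontinuity
    passes the bound to its limit. *)
Lemma prox_argmin (R : realType) (X : hilbertType R) (f : X -> \bar R) (x : X) :
  proper_function f -> lower_semicontinuous f -> econvex_function f ->
  is_argmin (fun y => f y + (2^-1 * `|x - y| ^+ 2)%:E)%E (prox f x).
Proof.
move=> [fNy [x0 fx0y]] lsc cvx.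
rewrite /prox; set h := fun y => _; apply: (xgetPex 0 (P := is_argmin h)).
have [c0 fx0] : exists c0, f x0 = c0%:E.
  by case: (f x0) (fNy x0) fx0y => // c0 _ _; exists c0.
have [B B0 minB] := convex_lsc_minorant cvx lsc fx0.
pose q y := 2^-1 * `|x - y| ^+ 2.
(* Collecting the real majorants of the objective gives a real infimum, free of extended
   arithmetic. *)
pose S := [set r : R | exists y, (f y <= (r - q y)%:E)%E].
have infS : has_inf S.
  split; first by exists (c0 + q x0), x0; rewrite fx0 lee_fin; lra.
  (* The constant comes from [convex_lsc_minorant], the triangle inequality and
     [B * a <= a^2 / 2 + B^2 / 2] with [a = |x - y|]. *)
  exists (c0 - 1 - B * `|x - x0| - 2^-1 * B ^+ 2) => r [y /minB].
  have : B * `|y - x0| <= B * (`|x - y| + `|x - x0|).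
    rewrite ler_wpM2l// (distrC x y).
    by rewrite (le_trans _ (ler_normD _ _))// addrA subrK.
  rewrite /q => h1 h2.
  have aux (a b d e : R) : B * b <= B * (a + d) ->
      c0 - 1 - B * b <= e - 2^-1 * a ^+ 2 ->
      c0 - 1 - B * d - 2^-1 * B ^+ 2 <= e.
    by move=> h3 h4; have := sqr_ge0 (a - B); rewrite sqrrB => h5; lra.
  exact: aux h1 h2.
pose I := inf S.
have minI y r : (f y <= r%:E)%E -> I <= r + q y.
  by move=> fyr; apply: ge_inf; [exact: infS.2|exists y; rewrite addrK].
have /choice[u uP] n : exists y, (f y <= (I + n.+1%:R^-1 - q y)%:E)%E.
  have [|r [y fyr] rI] := @inf_adherent _ S n.+1%:R^-1 _ infS.
    by rewrite invr_gt0.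
  by exists y; rewrite (le_trans fyr)// lee_fin lerB// ltW.
(* The objective at the midpoint is at least [I], so the quadratic gain [|u n - u k|^2 / 8] is at
   most the mean of the two errors. *)
have uB n k : `|u n - u k| ^+ 2 <= 4 * (n.+1%:R^-1 + k.+1%:R^-1).
  have half01 : 0 < (2^-1 : R) < 1 by lra.
  have aux (a b d e w : R) :
      I <= 2^-1 * (I + a - 2^-1 * d) + (1 - 2^-1) * (I + b - 2^-1 * e) +
           2^-1 * (2^-1 * d + 2^-1 * e - 4^-1 * w) -> w <= 4 * (a + b).
    by move=> ?; lra.
  have := minI _ _ (econvex_le cvx half01 (uP n) (uP k)).
  by rewrite /q parallelogram; apply: aux.
have cu : cauchy (u @ \oo).
  apply/cauchy_ballP => e e0; rewrite near_map2.
  have e80 : 0 < e ^+ 2 / 8 by rewrite divr_gt0// exprn_gt0.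
  have := @cvgr_lt _ _ _ _ _ _ (@cvg_harmonic R) _ e80.
  move=> small; near=> n k; rewrite -ball_normE/=.
  suff : `|u n - u k| ^+ 2 < e ^+ 2 by rewrite ltr_sqr ?nnegrE ?(ltW e0).
  apply: le_lt_trans (uB _ _) _.
  have aux (a b d : R) : a < d / 8 -> b < d / 8 -> 4 * (a + b) < d.
    by move=> ? ?; lra.
  by apply: aux; [near: n|near: k]; exact: small.
move: cu => /cauchy_cvgP/cvg_ex[p up].
exists p => z; rewrite /h.
have fp : (f p <= (I - q p)%:E)%E.
  apply: (lsc_le_cvg lsc up _ uP); apply: cvgB.
    rewrite -[X in _ --> X]addr0; apply: cvgD; first exact: cvg_cst.
    exact: cvg_harmonic.
  apply: cvgM; first exact: cvg_cst.
  by apply: cvgM; apply: cvg_norm; apply: cvgB => //; exact: cvg_cst.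
have := fNy z; case fz : (f z) => [r| |] // _; last by rewrite addye// leey.
have := minI z r; rewrite fz lexx => /(_ isT) Ir.
rewrite (le_trans (leeD2r _ fp))// -!EFinD lee_fin /q.
by rewrite subrK; exact: Ir.
Unshelve. all: by end_near. Qed.

(** The conclusion says that [x - p] is a subgradient of [f] at [p]: compare [p] with
    [t *: z + (1 - t) *: p], divide by [t] and let [t] tend to 0. *)
Lemma argmin_variational (R : realType) (X : hilbertType R) (f : X -> \bar R)
    (x p : X) :
  proper_function f -> econvex_function f ->
  is_argmin (fun y => f y + (2^-1 * `|x - y| ^+ 2)%:E)%E p ->
  exists2 c : R, f p = c%:E &
    forall z r, (f z <= r%:E)%E -> c + dot (x - p) (z - p) <= r.
Proof.
move=> [fNy [x0 fx0y]] cvx pmin.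
have [c fp] : exists c, f p = c%:E.
  have := pmin x0; case: (f p) (fNy p) => [c| |] // _; first by exists c.
  by case: (f x0) fx0y (fNy x0).
exists c => // z r fzr.
pose w : R := dot (x - p) (z - p); pose K : R := `|z - p| ^+ 2.
have K0 : 0 <= K by exact: sqr_ge0.
have key (t : R) : 0 < t < 1 -> c + w <= r + t * K.
  move=> t01; have /andP[t0 t1] := t01.
  have fpc : (f p <= c%:E)%E by rewrite fp.
  have := le_trans (pmin (t *: z + (1 - t) *: p))
    (leeD2r _ (econvex_le cvx t01 fzr fpc)).
  rewrite fp -!EFinD lee_fin.
  have -> : x - (t *: z + (1 - t) *: p) = (x - p) - t *: (z - p).
    rewrite scalerBl scale1r scalerBr !opprD !opprK !addrA.
    by congr (_ + _); exact: addrAC.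
  rewrite (sqr_normB _ (t *: _)) dotZr normrZ exprMn real_normK ?num_real// -/w -/K.
  move: (`|x - p| ^+ 2 : R) => d h.
  have {}h : t * (c + w) <= t * (r + t * K / 2) by lra.
  rewrite ler_pM2l// in h; rewrite (le_trans h)// lerD2l.
  by rewrite -mulrA ler_wpM2l ?(ltW t0)// ler_piMr//; lra.
apply/ler_addgt0Pr => e e0.
have K1 : 0 < K + 1 by lra.
(* Small enough for [t * K] to stay below [e]; the divisor is [K + 1] since [K] may vanish. *)
pose t : R := Num.min 2^-1 (e / (K + 1)).
have t01 : 0 < t < 1.
  by rewrite lt_min gt_min divr_gt0// andbT; apply/andP; split; [|apply/orP; left]; lra.
rewrite (le_trans (key t t01))// lerD2l.
have /andP[t0 _] := t01.
have : t * (K + 1) <= e by rewrite -ler_pdivlMr// ge_min lexx orbT.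
by rewrite mulrDr mulr1 => h; lra.
Qed.

(** Each variational inequality is tested at the other minimizer; in their sum the values of [f]
    cancel. *)
Lemma prox_firmly_nonexpansive (R : realType) (X : hilbertType R)
    (f : X -> \bar R) (x y : X) :
  proper_function f -> lower_semicontinuous f -> econvex_function f ->
  `|prox f x - prox f y| ^+ 2 <= dot (x - y) (prox f x - prox f y).
Proof.
move=> fP lsc cvx; have px := prox_argmin x fP lsc cvx.
have py := prox_argmin y fP lsc cvx.
move: (prox f x) (prox f y) px py => p q px py.
have [c fp pP] := argmin_variational fP cvx px.
have [d fq qP] := argmin_variational fP cvx py.
have := pP q d; rewrite fq lexx => /(_ isT) h1.
have := qP p c; rewrite fp lexx => /(_ isT) h2.
rewrite -subr_ge0.
suff -> : dot (x - y) (p - q) - `|p - q| ^+ 2 =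
    - (dot (x - p) (q - p) + dot (y - q) (p - q)) by lra.
rewrite -!dotxx !(dotDl, dotDr, dotNl, dotNr) (dotC q p); ring.
Qed.

Lemma proxB_norm_le (R : realType) (X : hilbertType R)
    (f : X -> \bar R) (x y : X) :
  proper_function f -> lower_semicontinuous f -> econvex_function f ->
  `|prox f x - prox f y| <= `|x - y|.
Proof.
move=> fP lsc cvx; have := prox_firmly_nonexpansive x y fP lsc cvx.
have := dot_le_norm (x - y) (prox f x - prox f y) => h1 h2.
have {h1 h2} := le_trans h2 h1; rewrite expr2.
have [->|n0] := eqVneq `|prox f x - prox f y| 0; first by [].
by rewrite ler_pM2r// lt_neqAle eq_sym n0 normr_ge0.
Qed.

(** Expanding the square leaves, besides [|x - y|^2], four times the difference of the two sides of
    firm nonexpansiveness. *)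
Lemma prox_reflection_nonexpansive (R : realType) (X : hilbertType R)
    (f : X -> \bar R) (x y : X) :
  proper_function f -> lower_semicontinuous f -> econvex_function f ->
  `|2 *: (prox f x - prox f y) - (x - y)| ^+ 2 <= `|x - y| ^+ 2.
Proof.
move=> fP lsc cvx; have := prox_firmly_nonexpansive x y fP lsc cvx.
rewrite (sqr_normB (2 *: _)) dotZl normrZ exprMn real_normK ?num_real// (dotC (x - y)).
move: (dot _ _ : R) (`|prox f x - prox f y| ^+ 2 : R) (`|x - y| ^+ 2 : R) => a b d.
by move=> h; lra.
Qed.

(* The minimizer [p] of [1/2 |y|^2 - phi y] represents [phi], since there the
   variational inequality says [phi w <= dot p w] for [w] and [- w]. *)
Lemma riesz_representation (R : realType) (X : hilbertType R) (phi : X -> R)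
    (C : R) :
  (forall a x y, phi (a *: x + y) = a * phi x + phi y) ->
  (forall x, `|phi x| <= C * `|x|) ->
  exists p, forall w, phi w = dot w p.
Proof.
move=> lin phiC; pose f (x : X) := (- phi x)%:E.
have phiD x y : phi (x + y) = phi x + phi y.
  by have := lin 1 x y; rewrite scale1r mul1r.
have phi0 : phi 0 = 0 by have := phiD 0 0; rewrite addr0 => h; lra.
have phiZ a x : phi (a *: x) = a * phi x.
  by have := lin a x 0; rewrite phi0 !addr0.
have phiN x : phi (- x) = - phi x by rewrite -scaleN1r phiZ mulN1r.
have fP : proper_function f by split=> // ; exists 0; rewrite ltry.
have cvx : econvex_function f.
  move=> t x y _; rewrite /f lin phiZ -!EFinM -EFinD lee_fin.
  by rewrite opprD !mulrN.
have lsc : lower_semicontinuous f.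
  move=> x a; rewrite lte_fin => ax.
  have C1 : 0 < `|C| + 1 by rewrite ltr_wpDl.
  pose d : R := (- phi x - a) / (`|C| + 1).
  have d0 : 0 < d by rewrite divr_gt0// subr_gt0.
  exists (ball x d); first exact: nbhsx_ballx.
  move=> y; rewrite -ball_normE/= distrC /f lte_fin => yx.
  have : phi y - phi x <= `|C| * d.
    rewrite -phiN -phiD (le_trans (ler_norm _))// (le_trans (phiC _))//.
    rewrite (@le_trans _ _ (`|C| * `|y - x|))//.
      by rewrite ler_wpM2r ?ler_norm.
    by rewrite ler_wpM2l// ltW.
  have : (`|C| + 1) * d = - phi x - a by rewrite mulrC divfK// gt_eqF.
  by rewrite mulrDl mul1r => ? ?; lra.
have pmin := prox_argmin 0 fP lsc cvx; move: (prox f 0) pmin => p pmin.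
have [c [fp] pP] := argmin_variational fP cvx pmin.
have le w : phi w <= dot w p.
  have := pP (p + w) (- phi (p + w)) (lexx _).
  by rewrite sub0r (addrC p) addrK dotNl (dotC p) phiD -fp => ?; lra.
exists p => w; apply/eqP; rewrite eq_le le/=.
by have := le (- w); rewrite phiN dotNl lerN2.
Qed.

(** * Adjoints and coordinates *)

Lemma bounded_fun_norm_linear (R : realType) (X Y : normedModType R)
    (A : {linear X -> Y}) : bounded_fun_norm A -> exists C, forall x, `|A x| <= C * `|x|.
Proof.
move=> /(_ 1) [M AM]; exists M => x.
have [->|x0] := eqVneq x 0; first by rewrite linear0 !normr0 mulr0.
have nx : 0 < `|x| by rewrite normr_gt0.
have := AM (`|x|^-1 *: x).
rewrite linearZ/= !normrZ ger0_norm ?invr_ge0// mulVf ?gt_eqF// lexx => /(_ isT).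
by rewrite mulrC ler_pdivrMr.
Qed.

(** The image of a ball has a compact, hence bounded, closure. *)
Lemma compact_operator_bounded (R : realType) (X Y : normedModType R)
    (A : X -> Y) : compact_operator A -> bounded_fun_norm A.
Proof.
move=> Ac r.
have : bounded_set (closure (A @` [set x | `|x| <= r])).
  apply: compact_bounded; rewrite -precompactE; apply: Ac.
  by exists r; split=> [|M rM x /= xr]; [exact: num_real|rewrite (le_trans xr)// ltW].
case=> M [_ MA]; exists (M + 1) => x xr; apply: (MA (M + 1)); first by rewrite ltrDl.
by apply: subset_closure; exists x.
Qed.

(** [adjoint] is a choice in a set that could be empty; representing the bounded functional
    [dot (A x) y] of [x] shows that it is not. *)
Lemma adjointP (R : realType) (X Y : hilbertType R) (A : {linear X -> Y})
    (C : R) (x : X) (y : Y) :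
  (forall x, `|A x| <= C * `|x|) -> dot (A x) y = dot x (adjoint A y).
Proof.
move=> Abnd; suff /(xgetPex 0)/(_ x) : [set z | forall x, dot (A x) y = dot x z] !=set0 by [].
apply: (@riesz_representation _ _ (fun x => dot (A x) y) (`|y| * C)).
  by move=> a u w; rewrite linearP dotDl dotZl.
move=> u; rewrite (le_trans (norm_dot_le _ _))// mulrC -mulrA.
by rewrite ler_wpM2l.
Qed.

Lemma orthonormal_basis_inj (R : realType) (X : hilbertType R) (v : nat -> X)
    (x y : X) :
  orthonormal_basis v -> (forall p, dot x (v p) = dot y (v p)) -> x = y.
Proof.
move=> [_ vB] xy; apply: (cvg_unique _ (vB x)); first exact: norm_hausdorff.
have <- : (fun p => dot y (v p) *: v p) = (fun p => dot x (v p) *: v p).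
  by apply/funext => p; rewrite xy.
exact: vB.
Qed.

(** Pair the expansion of [x] with [x] itself and use the continuity of [dot]. *)
Lemma parseval (R : realType) (X : hilbertType R) (v : nat -> X) (x : X) :
  orthonormal_basis v ->
  series (fun p => dot x (v p) ^+ 2) @ \oo --> `|x| ^+ 2.
Proof.
move=> [_ vB]; have := cvg_dotl (y := x) (vB x); rewrite dotxx.
rewrite (_ : (fun n => dot _ x) = series (fun p => dot x (v p) ^+ 2))//.
apply/funext => n; rewrite /series/= dot_suml; apply: eq_bigr => p _.
by rewrite dotZl expr2 (dotC (v p)).
Qed.

(** Summing over the coordinates and passing to the limit by Parseval reduces operator estimates to
    2 by 2 matrices. *)
Lemma coordinatewise_norm_le (R : realType) (X : hilbertType R) (v : nat -> X)
    (a : R) (x b w z : X) :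
  orthonormal_basis v ->
  (forall p, dot w (v p) ^+ 2 + dot z (v p) ^+ 2
             <= a * (dot x (v p) ^+ 2 + dot b (v p) ^+ 2)) ->
  `|w| ^+ 2 + `|z| ^+ 2 <= a * (`|x| ^+ 2 + `|b| ^+ 2).
Proof.
move=> vB le; pose c (y : X) := series (fun p => dot y (v p) ^+ 2).
have cE y : c y n @[n --> \oo] --> `|y| ^+ 2 by exact: parseval.
apply: (@ler_cvg_to _ \oo _ _ (fun n => c w n + c z n)
  (fun n => a * (c x n + c b n))).
- by apply: cvgD; exact: cE.
- by apply: cvgM; [exact: cvg_cst|apply: cvgD; exact: cE].
- apply: nearW => n; rewrite /c /series/= -!big_split/= mulr_sumr.
  by apply: ler_sum => p _; exact: le.
Qed.

(* The largest eigenvalue of [M^T M], where [M] is the matrix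
   [[beta, betat], [0, eta]], is the largest root [l] of
   [l^2 - s l + beta^2 eta^2], where [s] is the trace of [M^T M]. *)
Lemma singular_value_le (R : rcfType) (beta betat eta x b : R) :
  let s := beta ^+ 2 + betat ^+ 2 + eta ^+ 2 in
  (beta * x + betat * b) ^+ 2 + (eta * b) ^+ 2 <=
  2^-1 * (s + Num.sqrt (s ^+ 2 - 4 * beta ^+ 2 * eta ^+ 2)) * (x ^+ 2 + b ^+ 2).
Proof.
cbv zeta; set s := beta ^+ 2 + betat ^+ 2 + eta ^+ 2; set dl := s ^+ 2 - _; set l := 2^-1 * _.
have b2 := sqr_ge0 beta; have t2 := sqr_ge0 betat; have e2 := sqr_ge0 eta.
have dl0 : 0 <= dl.
  have -> : dl = betat ^+ 2 * (betat ^+ 2 + 2 * beta ^+ 2 + 2 * eta ^+ 2)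
      + (beta ^+ 2 - eta ^+ 2) ^+ 2 by rewrite /dl /s; ring.
  by rewrite addr_ge0 ?sqr_ge0// mulr_ge0// !addr_ge0// mulr_ge0.
have sq := sqr_sqrtr dl0; have q0 := sqrtr_ge0 dl.
(* These are the diagonal entries of [l Id - M^T M]. Its determinant vanishes, which is [AB], and
   its trace is [Num.sqrt dl]; hence both entries are nonnegative. *)
pose A := l - beta ^+ 2; pose B := l - betat ^+ 2 - eta ^+ 2.
have AB : A * B = (beta * betat) ^+ 2.
  have -> : A * B = l ^+ 2 - s * l + beta ^+ 2 * eta ^+ 2
      + (beta * betat) ^+ 2 by rewrite /A /B /s; ring.
  suff -> : l ^+ 2 - s * l + beta ^+ 2 * eta ^+ 2 = 0 by rewrite add0r.
  have -> : l ^+ 2 - s * l = 4^-1 * (Num.sqrt dl ^+ 2 - s ^+ 2).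
    by rewrite /l; field.
  by rewrite sq /dl; field.
have AB0 : 0 <= A + B by rewrite /A /B /l /s; lra.
have [A0 B0] : 0 <= A /\ 0 <= B.
  have : 0 <= A * B by rewrite AB sqr_ge0.
  split; nra.
rewrite -subr_ge0.
have -> : l * (x ^+ 2 + b ^+ 2) - ((beta * x + betat * b) ^+ 2 + (eta * b) ^+ 2)
   = A * x ^+ 2 - 2 * (beta * betat) * x * b + B * b ^+ 2.
  by rewrite /A /B; ring.
(* If [A = 0] then [beta * betat = 0] and the cross term disappears; otherwise multiplying by [A]
   completes the square. *)
have [A00|An0] := eqVneq A 0.
  move: AB; rewrite A00 mul0r => /esym/eqP; rewrite expf_eq0/= => /eqP ->.
  rewrite (_ : _ + _ = B * b ^+ 2); last ring.
  by rewrite mulr_ge0// sqr_ge0.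
have Ap : 0 < A by rewrite lt_neqAle eq_sym An0.
rewrite -(pmulr_rge0 _ Ap).
have -> : A * (A * x ^+ 2 - 2 * (beta * betat) * x * b + B * b ^+ 2)
   = A ^+ 2 * x ^+ 2 - 2 * A * (beta * betat) * x * b + (A * B) * b ^+ 2 by ring.
rewrite AB.
suff -> : A ^+ 2 * x ^+ 2 - 2 * A * (beta * betat) * x * b
   + (beta * betat) ^+ 2 * b ^+ 2 = (A * x - beta * betat * b) ^+ 2
   by exact: sqr_ge0.
ring.
Qed.

(** Cauchy-Schwarz in the plane, by Lagrange's identity. *)
Lemma lincomb_sqr_le (R : realDomainType) (a c x b : R) :
  (a * x + c * b) ^+ 2 <= (a ^+ 2 + c ^+ 2) * (x ^+ 2 + b ^+ 2).
Proof.
rewrite -subr_ge0.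
suff -> : (a ^+ 2 + c ^+ 2) * (x ^+ 2 + b ^+ 2) - (a * x + c * b) ^+ 2 =
  (a * b - c * x) ^+ 2 by exact: sqr_ge0.
ring.
Qed.

(** * Euclidean norm on the product space and products of layers *)

(** The canonical norm on pairs is the maximum of the two norms, hence a separate function. *)
Definition l2norm (R : realType) (X : normedModType R) (u : X * X) : R :=
  Num.sqrt (`|u.1| ^+ 2 + `|u.2| ^+ 2).

Lemma l2normD (R : realType) (X : normedModType R) (u w : X * X) :
  l2norm (u + w) <= l2norm u + l2norm w.
Proof.
rewrite /l2norm /=.
have sq0 (s t : R) : 0 <= s ^+ 2 + t ^+ 2 by rewrite addr_ge0// sqr_ge0.
have := ler_normD u.1 w.1; have := ler_normD u.2 w.2.
move: (normr_ge0 u.1) (normr_ge0 u.2) (normr_ge0 w.1) (normr_ge0 w.2).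
move: (normr_ge0 (u.1 + w.1)) (normr_ge0 (u.2 + w.2)).
move: (`|u.1| : R) (`|u.2| : R) (`|w.1| : R) (`|w.2| : R)
  (`|u.1 + w.1| : R) (`|u.2 + w.2| : R) => a b c d e f e0 f0 a0 b0 c0 d0 fle ele.
rewrite -ler_sqr ?nnegrE ?addr_ge0 ?sqrtr_ge0// sqrrD !sqr_sqrtr//.
have cs : a * c + b * d <= Num.sqrt (a ^+ 2 + b ^+ 2) * Num.sqrt (c ^+ 2 + d ^+ 2).
  rewrite -sqrtrM// -[leLHS]ger0_norm ?addr_ge0 ?mulr_ge0// -sqrtr_sqr.
  by rewrite ler_wsqrtr// lincomb_sqr_le.
have e2 : e ^+ 2 <= (a + c) ^+ 2 by rewrite ler_sqr ?nnegrE ?addr_ge0.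
have f2 : f ^+ 2 <= (b + d) ^+ 2 by rewrite ler_sqr ?nnegrE ?addr_ge0.
rewrite mulr2n; lra.
Qed.

(** The product [U n o ... o U i], which is the identity when [n < i]. Layers are numbered from 1,
    so [U 0] is never applied. *)
Fixpoint compose_range (V : Type) (U : nat -> V -> V) (i n : nat) (u : V) : V :=
  if n is n'.+1 then
    if (i <= n)%N then U n (compose_range U i n' u) else u
  else u.

Lemma compose_rangeS (V : Type) (U : nat -> V -> V) (i n : nat) (u : V) :
  (i <= n.+1)%N ->
  compose_range U i n.+1 u = U n.+1 (compose_range U i n u).
Proof. by move=> /= ->. Qed.

Lemma compose_range_gt (V : Type) (U : nat -> V -> V) (i n : nat) (u : V) :
  (n < i)%N -> compose_range U i n u = u.
Proof. by case: n => //= n; rewrite ltnNge => /negbTE ->. Qed.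

(** A discrete Duhamel formula: the perturbation [e i.-1] enters just before layer [i] and is
    carried by the layers [i] to [n]. *)
Lemma unroll_perturbed (V : zmodType) (U : nat -> V -> V) (d e : nat -> V) :
  (forall n, {morph U n : x y / x + y}) ->
  d 0 = 0 -> (forall n, d n.+1 = U n.+1 (d n + e n)) ->
  forall n, d n = \sum_(1 <= i < n.+1) compose_range U i n (e i.-1).
Proof.
move=> UD d0 dS; elim=> [|n IHn]; first by rewrite d0 big_geq.
have U0 k : U k 0 = 0 by apply: (addIr (U k 0)); rewrite -UD !add0r.
rewrite dS UD {}IHn [RHS]big_nat_recr// compose_rangeS// compose_range_gt//; congr (_ + _).
rewrite (big_morph (U n.+1) (UD _) (U0 _)) !big_nat.
by apply: eq_bigr => i /andP[_ ilt]; rewrite compose_rangeS// ltnW.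
Qed.

(** * Positive multiples of proper, lower semicontinuous, convex functions *)

Lemma proper_scale (R : realType) (X : Type) (s : R) (g : X -> \bar R) :
  0 < s -> proper_function g -> proper_function (fun x => s%:E * g x)%E.
Proof.
move=> s0 [gNy [x gx]]; split; last first.
  exists x; case: (g x) (gNy x) gx => [r| |]// _ _.
  by rewrite -EFinM ltry.
by move=> y; case: (g y) (gNy y) => [r| |]// _; rewrite gt0_muley// lte_fin.
Qed.

Lemma lsc_scale (R : realType) (X : topologicalType) (s : R) (g : X -> \bar R) :
  0 < s -> lower_semicontinuous g ->
  lower_semicontinuous (fun x => s%:E * g x)%E.
Proof.
move=> s0 lsc x a; rewrite -lte_pdivrMl// -EFinM => /lsc[V Vx Vg].
by exists V => // y /Vg; rewrite EFinM lte_pdivrMl.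
Qed.

Lemma econvex_scale (R : realType) (X : lmodType R) (s : R) (g : X -> \bar R) :
  0 < s -> (forall x, g x != -oo%E) -> econvex_function g ->
  econvex_function (fun x => s%:E * g x)%E.
Proof.
move=> s0 gNy cvx t x y t01; have /andP[t0 t1] := t01.
have s0' : (0 <= s%:E)%E by rewrite lee_fin ltW.
rewrite (le_trans (lee_wpmul2l s0' (cvx t x y t01)))//.
rewrite muleCA [in leRHS](muleCA (1 - t)%:E) muleDr//.
(* It remains to see that the sum to be distributed is well defined: neither of its terms is
   [-oo]. *)
case: (g x) (gNy x) => [a| |]// _; case: (g y) (gNy y) => [b| |]// _;
  rewrite ?gt0_muley ?lte_fin ?subr_gt0//.
Qed.

(** * Spectral coefficients *)

(** The real [sup] of an unbounded set is a default value; boundedness makes the suprema in the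
    coefficients genuine upper bounds. *)
Definition bounded_sequence (R : realType) (f : nat -> R) :=
  exists M, forall p, `|f p| <= M.

Lemma bounded_sequence_cst (R : realType) (a : R) :
  bounded_sequence (fun _ => a).
Proof. by exists `|a|. Qed.

Lemma bounded_sequenceD (R : realType) (f h : nat -> R) :
  bounded_sequence f -> bounded_sequence h ->
  bounded_sequence (fun p => f p + h p).
Proof.
move=> [M fM] [N hN]; exists (M + N) => p.
by rewrite (le_trans (ler_normD _ _))// lerD.
Qed.

Lemma bounded_sequenceM (R : realType) (f h : nat -> R) :
  bounded_sequence f -> bounded_sequence h ->
  bounded_sequence (fun p => f p * h p).
Proof.
by move=> [M fM] [N hN]; exists (M * N) => p; rewrite normrM ler_pM.
Qed.

Lemma bounded_sequence_prod (R : realType) (I : Type) (r : seq I)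
    (F : I -> nat -> R) :
  (forall i, bounded_sequence (F i)) ->
  bounded_sequence (fun p => \prod_(i <- r) F i p).
Proof.
move=> FB; elim: r => [|i r IHr].
  by exists 1 => p; rewrite big_nil normr1.
have [M FM] := bounded_sequenceM (FB i) IHr.
by exists M => p; rewrite big_cons.
Qed.

Lemma bounded_sequence_sum (R : realType) (I : Type) (r : seq I)
    (F : I -> nat -> R) :
  (forall i, bounded_sequence (F i)) ->
  bounded_sequence (fun p => \sum_(i <- r) F i p).
Proof.
move=> FB; elim: r => [|i r IHr].
  by exists 0 => p; rewrite big_nil normr0.
have [M FM] := bounded_sequenceD (FB i) IHr.
by exists M => p; rewrite big_cons.
Qed.

Lemma le_sup_range (R : realType) (f : nat -> R) (p : nat) :
  bounded_sequence f -> f p <= sup (range f).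
Proof.
move=> [M fM]; apply: ub_le_sup; last by exists p.
by exists M => _ [q _ <-]; rewrite (le_trans (ler_norm _)).
Qed.

(** As [v p] is a unit vector, [b p] equals [|A (v p)|^2]. *)
Lemma eigenvalue_bounded (R : realType) (X Y : hilbertType R)
    (A : {linear X -> Y}) (C : R) (v : nat -> X) (b : nat -> R) :
  (forall x, `|A x| <= C * `|x|) -> orthonormal_basis v ->
  (forall p, adjoint A (A (v p)) = b p *: v p) -> bounded_sequence b.
Proof.
move=> Abnd [v1 _] vb; exists (C ^+ 2) => p.
have vp1 : dot (v p) (v p) = 1 by rewrite v1 eqxx.
have nvp : `|v p| = 1.
  by apply: (@pexpIrn _ 2); rewrite ?nnegrE// expr1n -dotxx vp1.
have -> : b p = `|A (v p)| ^+ 2.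
  by rewrite -dotxx (adjointP _ _ Abnd) vb dotZr vp1 mulr1.
rewrite ger0_norm ?sqr_ge0// ler_sqr ?nnegrE//.
  by rewrite (le_trans (Abnd _))// nvp mulr1.
by have := Abnd (v p); rewrite nvp mulr1; exact: le_trans.
Qed.

Lemma dot_adjoint_eigenvector (R : realType) (X Y : hilbertType R)
    (A : {linear X -> Y}) (C a : R) (x w : X) :
  (forall x, `|A x| <= C * `|x|) -> adjoint A (A w) = a *: w ->
  dot (adjoint A (A x)) w = a * dot x w.
Proof.
by move=> Abnd Aw; rewrite dotC -(adjointP _ _ Abnd) dotC (adjointP _ _ Abnd) Aw dotZr.
Qed.

Section spectral_coefficients.
Context {R : realType} (lambda tau eta betaT betaD : nat -> R).
Local Notation beta := (beta lambda tau betaT betaD).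
Local Notation betaprod := (betaprod lambda tau betaT betaD).
Local Notation betatilde := (betatilde lambda tau eta betaT betaD).

Lemma betaprodS i n p : (i <= n.+1)%N ->
  betaprod i n.+1 p = beta n.+1 p * betaprod i n p.
Proof. by move=> ilen; rewrite /Defs.betaprod big_nat_recr//= mulrC. Qed.

Lemma etaprodS i n : (i <= n.+1)%N ->
  etaprod eta i n.+1 = eta n.+1 * etaprod eta i n.
Proof. by move=> ilen; rewrite /etaprod big_nat_recr//= mulrC. Qed.

(** The upper right entry of the product of [[[beta n.+1 p, lambda n.+1], [0, eta n.+1]]] with the
    matrix of the layers [i] to [n]. *)
Lemma betatildeS i n p : (0 < i <= n)%N ->
  betatilde i n.+1 p =
  beta n.+1 p * betatilde i n p + lambda n.+1 * etaprod eta i n.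
Proof.
move=> /andP[i0 ilen]; rewrite /Defs.betatilde/= big_nat_recr//=.
congr (_ + _); rewrite mulrDr mulr_sumr; congr (_ + _).
  rewrite !big_nat; apply: eq_bigr => j /andP[_ jn].
  by rewrite betaprodS ?mulrA// ltnW.
by rewrite betaprodS// /Defs.betaprod big_geq// mulr1 mulrA.
Qed.

(** For [i > 0] the product [etaprod eta i i.-1] is empty; at [i = 0] the truncated predecessor
    would leave a factor [eta 0]. *)
Lemma betatilde_diag i p : (0 < i)%N -> betatilde i i p = lambda i.
Proof.
move=> i0; rewrite /Defs.betatilde big_geq// add0r /etaprod prednK//.
by rewrite big_geq// mulr1.
Qed.

Hypotheses (bT : bounded_sequence betaT) (bD : bounded_sequence betaD).

Lemma beta_bounded n : bounded_sequence (beta n).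
Proof.
have [M bM] := bounded_sequenceD (bounded_sequence_cst 1)
  (bounded_sequenceM (bounded_sequence_cst (- lambda n))
    (bounded_sequenceD bT (bounded_sequenceM (bounded_sequence_cst (tau n)) bD))).
by exists M => p; rewrite /Defs.beta -mulNr.
Qed.

Lemma betaprod_bounded i n : bounded_sequence (betaprod i n).
Proof. by apply: bounded_sequence_prod => j; exact: beta_bounded. Qed.

Lemma betatilde_bounded i n : bounded_sequence (betatilde i n).
Proof.
apply: bounded_sequenceD; last exact: bounded_sequence_cst.
apply: bounded_sequence_sum => j.
apply: bounded_sequenceM; last exact: bounded_sequence_cst.
apply: bounded_sequenceM; last exact: bounded_sequence_cst.
exact: betaprod_bounded.
Qed.

Lemma le_a_ i n p (x b : R) :
  (betaprod i n p * x + betatilde i n p * b) ^+ 2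
    + (etaprod eta i n * b) ^+ 2
  <= a_ lambda tau eta betaT betaD i n * (x ^+ 2 + b ^+ 2).
Proof.
apply: le_trans (singular_value_le _ _ _ _ _) _.
rewrite ler_wpM2r ?addr_ge0 ?sqr_ge0// /a_ ler_wpM2l//.
have [M bM] := betaprod_bounded i n; have [N tN] := betatilde_bounded i n.
set f := fun q : nat => _; apply: (@le_sup_range _ f); rewrite /f.
(* [S] bounds the trace [s] for every index; the discriminant is at most [s ^+ 2], so the square
   root is bounded by [S] too. *)
pose S : R := M ^+ 2 + N ^+ 2 + etaprod eta i n ^+ 2.
exists (S + S) => q; cbv zeta.
set s := betaprod i n q ^+ 2 + _ + _.
have sq_le (y K : R) : `|y| <= K -> y ^+ 2 <= K ^+ 2.
  by move=> yK; rewrite -(real_normK (num_real y)) ler_sqr ?nnegrE ?(le_trans _ yK).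
have s0 : 0 <= s by rewrite !addr_ge0 ?sqr_ge0.
have sS : s <= S by rewrite lerD2r lerD// sq_le.
rewrite ger0_norm; last by apply: addr_ge0 => //; exact: sqrtr_ge0.
apply: lerD => //.
apply: le_trans sS; rewrite -[leRHS]ger0_norm// -sqrtr_sqr ler_wsqrtr//.
by rewrite gerBl -mulrA mulr_ge0// mulr_ge0// sqr_ge0.
Qed.

Lemma le_abar i n p (x b : R) :
  (betaprod i n p * x + betatilde i n p * b) ^+ 2
  <= abar lambda tau eta betaT betaD i n * (x ^+ 2 + b ^+ 2).
Proof.
apply: le_trans (lincomb_sqr_le _ _ _ _) _.
rewrite ler_wpM2r ?addr_ge0 ?sqr_ge0// /abar.
set f := fun q : nat => _; apply: (@le_sup_range _ f); rewrite /f.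
have bB := betaprod_bounded i n; have tB := betatilde_bounded i n.
by apply: bounded_sequenceD; exact: bounded_sequenceM.
Qed.

(** In both cases the input coordinates depend on the single scalar [b], so one coefficient is
    squared and no Cauchy-Schwarz loss occurs. *)
Lemma le_ahat1_last c n p (b : R) :
  (betaprod 1 n p * (if c is bias_input then b else 0)
    + betatilde 1 n p * b) ^+ 2
  <= ahat1_last lambda tau eta betaT betaD c n * b ^+ 2.
Proof.
have bB := betaprod_bounded 1 n; have tB := betatilde_bounded 1 n.
have sB := bounded_sequenceD bB tB.
case: c; rewrite /= ?mulr0 ?add0r -?mulrDl exprMn ler_wpM2r ?sqr_ge0//.
  set f := fun q : nat => _; apply: (@le_sup_range _ f).
  exact: bounded_sequenceM.
set f := fun q : nat => _; apply: (@le_sup_range _ f).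
exact: bounded_sequenceM.
Qed.

End spectral_coefficients.

Lemma le_l2norm (R : realType) (X : normedModType R) (a : R) (u w : X * X) :
  `|w.1| ^+ 2 + `|w.2| ^+ 2 <= a * (`|u.1| ^+ 2 + `|u.2| ^+ 2) ->
  l2norm w <= Num.sqrt a * l2norm u.
Proof.
move=> h; rewrite /l2norm [leRHS]mulrC -sqrtrM ?addr_ge0 ?sqr_ge0//.
by rewrite mulrC ler_wsqrtr.
Qed.

Lemma le_l2norm_sum (R : realType) (X : normedModType R) (I : Type)
    (r : seq I) (P : pred I) (F : I -> X * X) :
  l2norm (\sum_(i <- r | P i) F i) <= \sum_(i <- r | P i) l2norm (F i).
Proof.
elim/big_rec2: _ => [|i a u _ h].
  by rewrite /l2norm !normr0 expr0n/= addr0 sqrtr0.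
by rewrite (le_trans (l2normD _ _))// lerD2l.
Qed.

(** * The network *)

Section layers.
Context {R : realType} {X Y Z : hilbertType R}.
Variables (T : {linear X -> Y}) (D : {linear X -> Z}) (CT CD : R).
Variables (v : nat -> X) (betaT betaD : nat -> R) (g : X -> \bar R).
Variables (lambda mu tau eta : nat -> R).
Hypotheses (T_bnd : forall x, `|T x| <= CT * `|x|)
  (D_bnd : forall x, `|D x| <= CD * `|x|)
  (v_basis : orthonormal_basis v)
  (T_diag : forall p, adjoint T (T (v p)) = betaT p *: v p)
  (D_diag : forall p, adjoint D (D (v p)) = betaD p *: v p).

Local Notation W := (W_ T D lambda tau).
Local Notation U := (U_ T D lambda tau eta).
Local Notation Q := (Q_ g lambda mu).
Local Notation beta := (beta lambda tau betaT betaD).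
Local Notation betaprod := (betaprod lambda tau betaT betaD).
Local Notation betatilde := (betatilde lambda tau eta betaT betaD).
Local Notation a_ := (a_ lambda tau eta betaT betaD).
Local Notation abar := (abar lambda tau eta betaT betaD).
Local Notation ahat1 := (ahat1 lambda tau eta betaT betaD).
Local Notation ahat1_last := (ahat1_last lambda tau eta betaT betaD).
Local Notation theta := (theta lambda tau eta betaT betaD).

Let bT : bounded_sequence betaT := eigenvalue_bounded T_bnd v_basis T_diag.
Let bD : bounded_sequence betaD := eigenvalue_bounded D_bnd v_basis D_diag.

Lemma dot_W n x p : dot (W n x) (v p) = beta n p * dot x (v p).
Proof.
rewrite /W_ !dotDl !dotNl !dotZl (dot_adjoint_eigenvector _ T_bnd (T_diag p)).
rewrite (dot_adjoint_eigenvector _ D_bnd (D_diag p)) /Defs.beta; ring.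
Qed.

Lemma U_linear n (a : R) (u w : X * X) : U n (a *: u + w) = a *: U n u + U n w.
Proof.
(* [adjoint] is defined by choice and carries no linear structure; linearity of [W n] is read off
   the coordinates, where it acts by [beta n p]. *)
have Wlin x y : W n (a *: x + y) = a *: W n x + W n y.
  apply: (orthonormal_basis_inj v_basis) => p.
  by rewrite [RHS]dotDl dotZl !dot_W dotDl dotZl mulrDr mulrCA.
congr (_, _) => /=.
  by rewrite Wlin !scalerDr !scalerA (mulrC a) addrACA.
by rewrite scalerDr scalerA mulrC -scalerA.
Qed.

Lemma UD n : {morph U n : u w / u + w}.
Proof. by move=> u w; have := U_linear n 1 u w; rewrite !scale1r. Qed.

Lemma U0 n : U n 0 = 0.
Proof. by apply: (addIr (U n 0)); rewrite -UD !add0r. Qed.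

Lemma UZ n a u : U n (a *: u) = a *: U n u.
Proof. by have := U_linear n a u 0; rewrite U0 !addr0. Qed.

Lemma UB n u w : U n (u - w) = U n u - U n w.
Proof. by rewrite UD -scaleN1r UZ scaleN1r. Qed.

(** Induction on [n] from the single layer [n = i], each step being a product of triangular
    matrices. *)
Lemma dot_compose_U i n u p : (0 < i <= n)%N ->
  dot (compose_range U i n u).1 (v p)
    = betaprod i n p * dot u.1 (v p) + betatilde i n p * dot u.2 (v p) /\
  (compose_range U i n u).2 = etaprod eta i n *: u.2.
Proof.
move=> /andP[i0]; elim: n => [|n IHn]; first by rewrite leqn0; case: i i0.
rewrite leq_eqVlt => /predU1P[->|].
  rewrite compose_rangeS// compose_range_gt// /= dotDl dotZl dot_W.
  by rewrite /Defs.betaprod /etaprod !big_nat1 betatilde_diag.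
rewrite ltnS => ilen; have [IH1 IH2] := IHn ilen.
have ilen1 := leqW ilen.
rewrite compose_rangeS//= dotDl dotZl dot_W IH1 IH2 scalerA etaprodS//.
split=> //; rewrite betaprodS// betatildeS ?i0// dotZl; ring.
Qed.

Lemma compose_U_norm_le i n u : (0 < i <= n)%N ->
  l2norm (compose_range U i n u) <= Num.sqrt (a_ i n) * l2norm u.
Proof.
move=> i_n; apply/le_l2norm/(coordinatewise_norm_le v_basis) => p.
have [-> ->] := dot_compose_U u p i_n.
by rewrite dotZl; exact: le_a_.
Qed.

Lemma compose_U_fst_norm_le i n u : (0 < i <= n)%N ->
  `|(compose_range U i n u).1| <= Num.sqrt (abar i n) * l2norm u.
Proof.
move=> i_n; set w := (compose_range _ _ _ _).1.
(* Padding with a zero second component lets the estimate on pairs apply to the first component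
   alone. *)
suff : l2norm (w, 0) <= Num.sqrt (abar i n) * l2norm u.
  by rewrite {1}/l2norm/= normr0 expr0n addr0 sqrtr_sqr normr_id.
apply/le_l2norm/(coordinatewise_norm_le v_basis) => p /=.
have [-> _] := dot_compose_U u p i_n.
by rewrite dot0l expr0n addr0; exact: le_abar.
Qed.

(** * The input layer *)

(** Both forms of [Uhat1] are [U 1] after this linear embedding, so that layer 1 fits the same
    recursion as the others. *)
Definition input (c : input_case) (b : X) : X * X :=
  (if c is bias_input then b else 0, b).

Lemma Uhat1E c b : Uhat1 T D lambda tau eta c b = U 1 (input c b).
Proof. by case: c. Qed.

Lemma inputB c b b' : input c (b - b') = input c b - input c b'.
Proof. by case: c => //=; congr (_, _); rewrite /= subr0. Qed.

Lemma compose_U_input_fst_sqr_le c n b : (0 < n)%N ->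
  `|(compose_range U 1 n (input c b)).1| ^+ 2 <= ahat1_last c n * `|b| ^+ 2.
Proof.
move=> n0; set w := (compose_range _ _ _ _).1.
have := @coordinatewise_norm_le _ _ v (ahat1_last c n) b 0 w 0 v_basis.
rewrite normr0 expr0n/= !addr0; apply=> p.
have [-> _] := dot_compose_U (input c b) p (n0 : (0 < 1 <= n)%N).
rewrite dot0l expr0n/= !addr0.
have -> : dot (input c b).1 (v p) = if c is bias_input then dot b (v p) else 0.
  by case: (c); rewrite /= ?dot0l.
exact: le_ahat1_last.
Qed.

Lemma compose_U_input_fst_norm_le c n b : (0 < n)%N ->
  `|(compose_range U 1 n (input c b)).1| <= Num.sqrt (ahat1_last c n) * `|b|.
Proof.
move=> n0; have := compose_U_input_fst_sqr_le c b n0.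
move=> /ler_wsqrtr; rewrite sqrtr_sqr normr_id mulrC sqrtrM ?sqr_ge0//.
by rewrite sqrtr_sqr normr_id mulrC.
Qed.

Lemma compose_U_input_norm_le c n b : (0 < n)%N ->
  l2norm (compose_range U 1 n (input c b)) <= Num.sqrt (ahat1 c n) * `|b|.
Proof.
move=> n0.
have -> : `|b| = l2norm (b, 0 : X).
  by rewrite /l2norm/= normr0 expr0n addr0 sqrtr_sqr normr_id.
apply: le_l2norm; rewrite /= normr0 expr0n addr0 mulrDl lerD//.
  exact: compose_U_input_fst_sqr_le.
(* The coordinate index 0 is arbitrary: only the formula for the second component, which gives the
   extra term of [ahat1], is kept. *)
have [_ ->] := dot_compose_U (input c b) 0 (n0 : (0 < 1 <= n)%N).
by rewrite normrZ exprMn real_normK ?num_real.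
Qed.

(** * Recursion for the gap between two inputs *)

Hypotheses (g_proper : proper_function g) (g_lsc : lower_semicontinuous g)
  (g_convex : econvex_function g).

Lemma R_norm_le n x y : 0 < lambda n * mu n ->
  `|R_ g lambda mu n x - R_ g lambda mu n y| <= `|x - y|.
Proof.
move=> s0; apply: proxB_norm_le; [exact: proper_scale|exact: lsc_scale|].
by apply: econvex_scale => //; case: g_proper.
Qed.

Lemma Q_reflection_norm_le n u w : 0 < lambda n * mu n ->
  l2norm (2 *: (Q n u - Q n w) - (u - w)) <= l2norm (u - w).
Proof.
move=> s0; apply: ler_wsqrtr; rewrite /= lerD//.
  apply: prox_reflection_nonexpansive; [exact: proper_scale|exact: lsc_scale|].
  by apply: econvex_scale => //; case: g_proper.
(* [Q n] fixes the second component, where its reflection is therefore the identity. *)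
by rewrite scaler_nat mulr2n addrK.
Qed.

Variable c : input_case.

(** The value 0 at index 0 is a convention that starts the recursion. [hidden] is indexed from 0, so
    [hidden n'] is the output of layer [n'.+1] and feeds layer [n'.+2]. *)
Definition preactivation (n : nat) (b : X) : X * X :=
  match n with
  | 0 => 0
  | 1 => Uhat1 T D lambda tau eta c b
  | n'.+2 => U n (hidden T D g lambda mu tau eta c n' b)
  end.

Lemma hiddenE n b :
  hidden T D g lambda mu tau eta c n b = Q n.+1 (preactivation n.+1 b).
Proof. by case: n. Qed.

(** [Ubar m] is the first component of [U m], so the last layer can be treated like the hidden ones
    and projected afterwards. *)
Lemma networkE m b : (2 <= m)%N ->
  network T D g lambda mu tau eta c m b = R_ g lambda mu m (preactivation m b).1.
Proof. by case: m => [|[|m]]//= _; rewrite /network/= subn2. Qed.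

Variables (b b' : X).

Definition scaled_gap (n : nat) : X * X :=
  2 ^+ n.-1 *: (preactivation n b - preactivation n b').

Definition reflected_gap (n : nat) : X * X :=
  if n is 0 then input c (b - b') else
  2 ^+ n.-1 *: (2 *: (Q n (preactivation n b) - Q n (preactivation n b'))
                - (preactivation n b - preactivation n b')).

(* [Q n] is the average of the identity and of its reflection [2 Q n - Id];
   the powers of 2 in the gaps absorb the factors 1/2. *)
Lemma scaled_gapS n : scaled_gap n.+1 = U n.+1 (scaled_gap n + reflected_gap n).
Proof.
case: n => [|n]; rewrite /scaled_gap /reflected_gap /=.
  by rewrite subrr scaler0 add0r expr0 scale1r !Uhat1E inputB UB.
rewrite !hiddenE -scalerDr (addrC _ (2 *: _ - _)) subrK scalerA -exprSr.
by rewrite UZ UB.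
Qed.

Lemma reflected_gap_le n : (0 < n)%N -> 0 < lambda n * mu n ->
  l2norm (reflected_gap n) <= l2norm (scaled_gap n).
Proof.
case: n => // n _ s0.
have l2normZ (a : R) (u : X * X) : l2norm (a *: u) = `|a| * l2norm u.
  rewrite /l2norm/= !normrZ !exprMn -mulrDr sqrtrM ?sqr_ge0// sqrtr_sqr.
  by rewrite normr_id.
by rewrite /scaled_gap /reflected_gap !l2normZ ler_wpM2l// Q_reflection_norm_le.
Qed.

Lemma scaled_gapE n :
  scaled_gap n = \sum_(1 <= i < n.+1) compose_range U i n (reflected_gap i.-1).
Proof.
apply: unroll_perturbed; [exact: UD| |exact: scaled_gapS].
by rewrite /scaled_gap subrr scaler0.
Qed.

Variable m : nat.
Hypothesis pos : forall n, (1 <= n <= m)%N -> 0 < lambda n * mu n.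

(** Strong induction, since the gap at layer [n] involves all earlier ones: the term [i = 1] carries
    the input, and for [i >= 2] the reflected gap at [i.-1] is bounded by induction. *)
Lemma scaled_gap_le n : (0 < n <= m)%N ->
  l2norm (scaled_gap n) <= theta c n * `|b - b'|.
Proof.
elim/ltn_ind: n => n IHn /andP[n0 nm].
rewrite thetaE// scaled_gapE big_ltn// mulrDl.
rewrite (le_trans (l2normD _ _))// lerD// ?compose_U_input_norm_le//.
rewrite (le_trans (le_l2norm_sum _ _ _))// mulr_suml !big_nat.
apply: ler_sum => -[|[|i]] // /andP[_]; rewrite ltnS => i_n.
rewrite (le_trans (compose_U_norm_le _ _))// mulrAC mulrC.
rewrite ler_wpM2r ?sqrtr_ge0//=.
have im : (0 < i.+1 <= m)%N by rewrite /= (leq_trans _ nm)// ltnW.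
by rewrite (le_trans (reflected_gap_le _ (pos im)))// IHn.
Qed.

(** The last layer drops the bias component, so the same splitting is estimated with [ahat1_last]
    and [abar]. *)
Lemma scaled_gap_fst_le : (0 < m)%N ->
  `|(scaled_gap m).1| <= theta_last lambda tau eta betaT betaD c m * `|b - b'|.
Proof.
move=> m0; rewrite /theta_last scaled_gapE big_ltn// mulrDl.
rewrite (le_trans (ler_normD _ _))// lerD// ?compose_U_input_fst_norm_le//.
rewrite (big_morph fst (id1 := 0) (op1 := +%R))//.
rewrite (le_trans (ler_norm_sum _ _ _))// mulr_suml !big_nat.
apply: ler_sum => -[|[|i]] // /andP[_]; rewrite ltnS => i_n.
rewrite (le_trans (compose_U_fst_norm_le _ _))// mulrAC mulrC.
rewrite ler_wpM2r ?sqrtr_ge0//=.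
have im : (0 < i.+1 <= m)%N by rewrite /= ltnW.
by rewrite (le_trans (reflected_gap_le _ (pos im)))// scaled_gap_le.
Qed.

End layers.

Theorem proposition3p12 (R : realType) (X Y Z : hilbertType R)
    (evX : X -> R -> R) (evY : Y -> R -> R) (k : R * R -> R)
    (T : {linear X -> Y}) (D : {linear X -> Z})
    (v : nat -> X) (betaT betaD : nat -> R) (g : X -> \bar R)
    (m : nat) (lambda mu tau eta : nat -> R)
    (XF : function_space evX) (YF : function_space evY)
    (k_L2 : square_integrable_kernel k)
    (T_integral : integral_operator evX evY k T)
    (T_compact : compact_operator T)
    (D_bounded : bounded_fun_norm D)
    (TD_commute : forall x,
      adjoint T (T (adjoint D (D x))) = adjoint D (D (adjoint T (T x))))
    (v_basis : orthonormal_basis v)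
    (T_diag : forall p, adjoint T (T (v p)) = betaT p *: v p)
    (D_diag : forall p, adjoint D (D (v p)) = betaD p *: v p)
    (g_proper : proper_function g)
    (g_lsc : lower_semicontinuous g)
    (g_convex : econvex_function g)
    (m_ge2 : (2 <= m)%N)
    (pos : forall n, (1 <= n <= m)%N ->
      [/\ 0 < lambda n, 0 < mu n, 0 < tau n & 0 < eta n])
    (c : input_case) :
  (theta_last lambda tau eta betaT betaD c m / 2 ^+ (m - 1)).-lipschitz
    (network T D g lambda mu tau eta c m).
Proof.
have [CT T_bnd] := bounded_fun_norm_linear (compact_operator_bounded T_compact).
have [CD D_bnd] := bounded_fun_norm_linear D_bounded.
have pos_prox n : (1 <= n <= m)%N -> 0 < lambda n * mu n.
  by move=> /pos[l0 u0 _ _]; rewrite mulr_gt0.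
have m0 : (0 < m)%N by rewrite ltnW.
move=> [b b'] _ /=; rewrite !networkE//.
rewrite (le_trans (R_norm_le g_proper g_lsc g_convex _ _ _))// ?pos_prox ?m0 ?leqnn//.
(* The final [R_] contributes a factor 1 only; the power of 2 is the one built into
   [scaled_gap m]. *)
rewrite mulrAC ler_pdivlMr ?exprn_gt0// mulrC subn1.
have := scaled_gap_fst_le tau eta T_bnd D_bnd v_basis T_diag D_diag g_proper g_lsc
  g_convex c b b' pos_prox m0.
by rewrite /scaled_gap/= normrZ ger0_norm// exprn_ge0.
Qed.
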